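(* Let $m<n$ be positive integers, $A\in\mathbb{C}^{m\times n}$, $b\in\mathbb{C}^m$ and $\mu>0$. Let $\tau,\gamma>0$ satisfy $\tau\lambda_{\max}+\gamma<2$, where $\lambda_{\max}$ denotes the maximum eigenvalue of $A^*A$. Let $\beta>0$ be fixed. For an arbitrary starting point $(x^0,y^0)\in\mathbb{C}^n\times\mathbb{C}^m$, let the sequence $\{(r^k,x^k,y^k)\}$ be generated, for $k=0,1,2,\dots$, by $$r^{k+1}=\frac{\mu\beta}{1+\mu\beta}\left(y^k/\beta-(Ax^k-b)\right),$$ $$x^{k+1}=\mathrm{Shrink}\left(x^k-\tau g^k,\ \frac{\tau}{\beta}\right),\qquad g^k:=A^*\left(Ax^k+r^{k+1}-b-y^k/\beta\right),$$ $$y^{k+1}=y^k-\gamma\beta\left(Ax^{k+1}+r^{k+1}-b\right).$$ Then $\{(r^k,x^k,y^k)\}$ converges to some $(\tilde r,\tilde x,\tilde y)\in\mathbb{C}^m\times\mathbb{C}^n\times\mathbb{C}^m$, where $(\tilde r,\tilde x)$ is a solution of $$\min_{x\in\mathbb{C}^n,\ r\in\mathbb{C}^m}\left\{\|x\|_1+\frac{1}{2\mu}\|r\|^2:\ Ax+r=b\right\}.$$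
   Context: $\|\cdot\|$ is the Euclidean ($\ell_2$) norm, $\|x\|_1=\sum_i|x_i|$ with $|\cdot|$ the complex modulus, and $A^*$ is the conjugate transpose of $A$. For $v\in\mathbb{C}^n$ and $t>0$, the shrinkage (soft-thresholding) operator is defined componentwise by $\mathrm{Shrink}(v,t)_i=\max\{|v_i|-t,0\}\,\mathrm{sign}(v_i)$, where $\mathrm{sign}(z)=z/|z|$ for $z\neq 0$ and $\mathrm{sign}(0)=0$. The sequence is indexed by $k\ge 1$ (the iteration needs no initial $r^0$). *)

(* Defs.v *)
From HB Require Import structures.
From mathcomp Require Import all_boot all_order all_algebra.
From mathcomp Require Export complex.
From mathcomp Require Import all_classical all_reals all_analysis.

Set Implicit Arguments.
Unset Strict Implicit.
Unset Printing Implicit Defensive.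

Import Order.TTheory GRing.Theory Num.Theory.
Import numFieldNormedType.Exports.

Local Open Scope ring_scope.
Local Open Scope complex_scope.

(* The topology of the modulus; the library declares it only on abstract number
   fields, which inference does not see through at R[i].  The one on
   'M[R[i]]_(p, q) is then the entrywise topology. *)
HB.instance Definition _ (R : rcfType) :=
  PseudoPointedMetric.copy R[i] (R[i])^o.

(* On R[i], [a <= b] means that b - a is a nonnegative real.  So this predicate
   says that l is an eigenvalue, that every eigenvalue is real, and that l
   bounds them all; the second part is automatic for Hermitian M. *)
Definition is_max_eigenvalue (R : realType) (p : nat) (M : 'M[R[i]]_p)
    (l : R) : Prop :=
  eigenvalue M l%:C /\ forall a : R[i], eigenvalue M a -> a <= l%:C.

(* [Num.sg] is not the complex sign: it is -1 at every z with ~~ (0 <= z). *)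
Definition csign (R : realType) (z : R[i]) : R[i] :=
  if z == 0 then 0 else z / `|z|.

Definition shrink (R : realType) (p : nat) (v : 'cV[R[i]]_p) (t : R) :
  'cV[R[i]]_p :=
  \col_i ((Num.max (Normc.normc (v i ord0) - t) 0)%:C * csign (v i ord0)).

(* These are real-valued.  The library norm on 'cV[R[i]]_p is the sup norm,
   with values in R[i]. *)
Definition norm1 (R : realType) (p : nat) (v : 'cV[R[i]]_p) : R :=
  \sum_i Normc.normc (v i ord0).

Definition norm2 (R : realType) (p : nat) (v : 'cV[R[i]]_p) : R :=
  Num.sqrt (\sum_i Normc.normc (v i ord0) ^+ 2).

Definition feasible (R : realType) (m n : nat) (A : 'M[R[i]]_(m, n))
    (b : 'cV[R[i]]_m) (r : 'cV[R[i]]_m) (x : 'cV[R[i]]_n) : Prop :=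
  A *m x + r = b.

Definition objective (R : realType) (m n : nat) (mu : R)
    (r : 'cV[R[i]]_m) (x : 'cV[R[i]]_n) : R :=
  norm1 x + (2 * mu)^-1 * norm2 r ^+ 2.

Definition is_solution (R : realType) (m n : nat) (A : 'M[R[i]]_(m, n))
    (b : 'cV[R[i]]_m) (mu : R) (r : 'cV[R[i]]_m) (x : 'cV[R[i]]_n) : Prop :=
  feasible A b r x /\
  forall (r' : 'cV[R[i]]_m) (x' : 'cV[R[i]]_n),
    feasible A b r' x' -> objective mu r x <= objective mu r' x'.

(* Main.v *)
(* Let (xs, ys) be a KKT pair, and weigh the errors by
   V_k = (beta / tau) |x_k - xs|^2 + (gamma beta)^-1 |y_k - ys|^2.  Adding the
   proximal inequality of the shrinkage step to the optimality of xs yields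
   V_k - V_(k+1) >= a |x_k - x_(k+1)|^2 + c |y_k - y_(k+1)|^2, where a, c > 0
   because tau lmax + gamma < 2.  So (x_k, y_k) is bounded with vanishing
   increments, and each of its cluster points is again a KKT pair; the V built
   on a cluster point is nonincreasing and tends to 0 along a subsequence, hence
   tends to 0.  A first KKT pair exists because |x|_1 + |b - A x|^2 / (2 mu) has
   a minimizer. *)
Require Import Defs.
From HB Require Import structures.
From mathcomp Require Import all_boot all_order all_algebra.
From mathcomp Require Import complex.
From mathcomp Require Import all_classical all_reals all_analysis.
From mathcomp Require Import ring lra.
Import Order.TTheory GRing.Theory Num.Theory.
Import numFieldNormedType.Exports.
Local Open Scope classical_set_scope.
Local Open Scope ring_scope.
Local Open Scope complex_scope.
Local Open Scope sesquilinear_scope.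

(** * The real inner product on complex vectors *)

(** Keeping only the real part turns C^p into the Euclidean space R^(2p): the form is symmetric and
    R-bilinear, as convex inequalities require, and the adjoint of a complex matrix is still its
    conjugate transpose. *)
Definition dot {R : realType} {p : nat} (u v : 'cV[R[i]]_p) : R :=
  complex.Re ((u^t* *m v) ord0 ord0).

Lemma ReZ {R : realType} (a : R) (z : R[i]) :
  complex.Re (a%:C * z) = a * complex.Re z.
Proof. by case: z => c d /=; rewrite mul0r subr0. Qed.

Lemma dotE {R : realType} {p : nat} (u v : 'cV[R[i]]_p) :
  dot u v = \sum_i (complex.Re (u i ord0) * complex.Re (v i ord0) +
                    complex.Im (u i ord0) * complex.Im (v i ord0)).
Proof.
rewrite /dot mxE raddf_sum; apply: eq_bigr => i _ /=; rewrite !mxE.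
by case: (u i ord0) => a c; case: (v i ord0) => d e /=; ring.
Qed.

Lemma dotC {R : realType} {p : nat} (u v : 'cV[R[i]]_p) : dot u v = dot v u.
Proof. by rewrite !dotE; apply: eq_bigr => i _; ring. Qed.

Lemma dotDr {R : realType} {p : nat} (u v w : 'cV[R[i]]_p) :
  dot u (v + w) = dot u v + dot u w.
Proof. by rewrite /dot mulmxDr mxE raddfD. Qed.

Lemma dotNr {R : realType} {p : nat} (u v : 'cV[R[i]]_p) :
  dot u (- v) = - dot u v.
Proof. by rewrite /dot mulmxN mxE raddfN. Qed.

Lemma dotZr {R : realType} {p : nat} (a : R) (u v : 'cV[R[i]]_p) :
  dot u (a%:C *: v) = a * dot u v.
Proof. by rewrite /dot -scalemxAr mxE ReZ. Qed.

Lemma dotDl {R : realType} {p : nat} (u v w : 'cV[R[i]]_p) :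
  dot (u + v) w = dot u w + dot v w.
Proof. by rewrite dotC dotDr !(dotC w). Qed.

Lemma dotNl {R : realType} {p : nat} (u v : 'cV[R[i]]_p) :
  dot (- u) v = - dot u v.
Proof. by rewrite dotC dotNr dotC. Qed.

Lemma dotZl {R : realType} {p : nat} (a : R) (u v : 'cV[R[i]]_p) :
  dot (a%:C *: u) v = a * dot u v.
Proof. by rewrite dotC dotZr dotC. Qed.

Lemma dot0l {R : realType} {p : nat} (u : 'cV[R[i]]_p) : dot 0 u = 0.
Proof. by rewrite /dot trmx0 map_mx0 mul0mx mxE. Qed.

Lemma dot_adjoint {R : realType} {p q : nat} (A : 'M[R[i]]_(p, q)) u v :
  dot (A *m u) v = dot u (A^t* *m v).
Proof. by rewrite /dot trmx_mul map_mxM mulmxA. Qed.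

Lemma dot_ge0 {R : realType} {p : nat} (u : 'cV[R[i]]_p) : 0 <= dot u u.
Proof.
by rewrite dotE; apply: sumr_ge0 => i _; rewrite -!expr2 addr_ge0 ?sqr_ge0.
Qed.

Lemma sqr_normcE {R : realType} (z : R[i]) :
  Normc.normc z ^+ 2 = complex.Re z ^+ 2 + complex.Im z ^+ 2.
Proof. by case: z => a c /=; rewrite sqr_sqrtr // addr_ge0 ?sqr_ge0. Qed.

Lemma normc_ge0 {R : realType} (z : R[i]) : 0 <= Normc.normc z.
Proof. by case: z => a c /=; exact: sqrtr_ge0. Qed.

Lemma dot_normc {R : realType} {p : nat} (u : 'cV[R[i]]_p) :
  dot u u = \sum_i Normc.normc (u i ord0) ^+ 2.
Proof. by rewrite dotE; apply: eq_bigr => i _; rewrite sqr_normcE -!expr2. Qed.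

Lemma sqr_norm2 {R : realType} {p : nat} (u : 'cV[R[i]]_p) :
  norm2 u ^+ 2 = dot u u.
Proof. by rewrite /norm2 sqr_sqrtr -dot_normc // dot_ge0. Qed.

Lemma dot_col_mx {R : realType} {p q : nat} (u u' : 'cV[R[i]]_p)
    (v v' : 'cV[R[i]]_q) :
  dot (col_mx u v) (col_mx u' v') = dot u u' + dot v v'.
Proof.
rewrite !dotE big_split_ord /=.
by congr (_ + _); apply: eq_bigr => i _; rewrite ?col_mxEu ?col_mxEd.
Qed.

Lemma dot_young {R : realType} {p : nat} (c : R) (u v : 'cV[R[i]]_p) : 0 < c ->
  2 * dot u v <= c * dot u u + c^-1 * dot v v.
Proof.
move=> c0; have := dot_ge0 (c%:C *: u - v).
rewrite !(dotDl, dotDr, dotNl, dotNr, dotZl, dotZr) (dotC v u).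
move: (dot u u) (dot u v) (dot v v) => P S Q h.
rewrite -subr_ge0; have -> : c * P + c^-1 * Q - 2 * S =
  c^-1 * (c * (c * P) - c * S - (c * S - Q)).
  by field; rewrite gt_eqF.
by apply: mulr_ge0; [rewrite invr_ge0 ltW | lra].
Qed.

(** * The spectral bound for the Gram matrix *)

(** [A^t* *m A] is normal, hence unitarily diagonalizable. Eigenvectors are row vectors here, so row
    [i] of [P] is one for the [i]-th diagonal entry. *)
Lemma Gram_spectral {C : numClosedFieldType} {p q : nat} (A : 'M[C]_(p, q)) :
  exists (P : 'M[C]_q) (d : 'rV[C]_q),
    [/\ P^t* *m P = 1%:M, A^t* *m A = P^t* *m diag_mx d *m P &
        forall i, eigenvalue (A^t* *m A) (d ord0 i)].
Proof.
set M := A^t* *m A; exists (spectralmx M), (spectral_diag M).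
have Mn : M \is normalmx.
  by apply/normalmxP; rewrite /M trmx_mul map_mxM /= trmxCK.
have Pu := spectral_unitarymx M.
have PV := invmx_unitary Pu.
have PPt : spectralmx M *m (spectralmx M)^t* = 1%:M by exact/unitarymxP.
have ME : M = (spectralmx M)^t* *m diag_mx (spectral_diag M) *m spectralmx M.
  by rewrite -PV; exact/orthomx_spectralP.
split => [//||i]; first by rewrite -PV mulVmx // unitarymx_unit.
  exact: ME.
move: ME PPt; move: (spectralmx M) (spectral_diag M) => P d ME PPt.
apply/eigenvalueP; exists (row i P).
  rewrite -row_mul ME !mulmxA PPt mul1mx row_mul.
  by rewrite row_diag_mx -scalemxAl -rowE.
(* A zero row would make the diagonal entry [(i, i)] of [P P^t* = 1] vanish. *)
apply/negP => /eqP rP0; have /matrixP/(_ i i) := PPt.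
rewrite !mxE eqxx /= => /eqP; rewrite big1 => [|j _].
  by rewrite eq_sym oner_eq0.
by move/rowP/(_ j): rP0; rewrite !mxE => ->; rewrite mul0r.
Qed.

Lemma dot_Gram_le {R : realType} {p q : nat} (A : 'M[R[i]]_(p, q)) (l : R) :
  is_max_eigenvalue (A^t* *m A) l ->
  forall u, dot (A *m u) (A *m u) <= l * dot u u.
Proof.
move=> [_ lP] u; have [P [d [PtP ME dP]]] := Gram_spectral A.
have -> : dot (A *m u) (A *m u) = dot (P *m u) (diag_mx d *m (P *m u)).
  by rewrite !dot_adjoint !mulmxA ME.
have -> : dot u u = dot (P *m u) (P *m u).
  by rewrite dot_adjoint mulmxA PtP mul1mx.
move: (P *m u) => w; rewrite !dotE mulr_sumr; apply: ler_sum => i _.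
(* An inequality in [R[i]] forces equal imaginary parts, so each diagonal entry is real and at most
   [l]. *)
rewrite mul_diag_mx mxE; move: (lP _ (dP i)); rewrite lecE /=.
case: (d ord0 i) => a c /=; case: (w i ord0) => e f /=.
move=> /andP[/eqP <- al]; rewrite mul0r mul0r subr0 addr0.
rewrite -subr_ge0; have -> : l * (e * e + f * f) - (e * (a * e) + f * (a * f)) =
  (l - a) * (e ^+ 2 + f ^+ 2) by ring.
by rewrite mulr_ge0 ?subr_ge0 ?addr_ge0 ?sqr_ge0.
Qed.

(** * Soft-thresholding as a proximal map *)

Lemma cauchy_normc {R : realType} (z w : R[i]) :
  complex.Re z * complex.Re w + complex.Im z * complex.Im w
    <= Normc.normc z * Normc.normc w.
Proof.
apply: le_trans (ler_norm _) _.
rewrite -ler_sqr ?nnegrE ?mulr_ge0 ?normc_ge0 // exprMn !sqr_normcE.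
rewrite real_normK ?num_real //.
rewrite -subr_ge0; set e := (X in 0 <= X).
have -> : e = (complex.Re z * complex.Im w - complex.Im z * complex.Re w) ^+ 2.
  by rewrite /e; ring.
exact: sqr_ge0.
Qed.

Lemma normcR {R : realType} (a : R) : 0 <= a -> Normc.normc a%:C = a.
Proof. by move=> a0; rewrite /= expr0n /= addr0 sqrtr_sqr ger0_norm. Qed.

(* Soft-thresholding is the proximal map of the modulus, in variational form. *)
Lemma prox_normc {R : realType} (z w s : R[i]) (t : R) : 0 < t ->
  s = (Num.max (Normc.normc z - t) 0)%:C * csign z ->
  complex.Re (z - s) * complex.Re (w - s) +
    complex.Im (z - s) * complex.Im (w - s)
    <= t * (Normc.normc w - Normc.normc s).
Proof.
move=> t0 sE0; have zw := cauchy_normc z w; have w0 := normc_ge0 w.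
(* Below the threshold [s = 0], and the claim is Cauchy-Schwarz followed by [|z| <= t]. *)
have [zt|zt] := leP (Normc.normc z) t.
  have -> : s = 0 by rewrite sE0 max_r ?subr_le0 // mul0r.
  rewrite !subr0 Normc.normc0 subr0; apply: le_trans zw _.
  exact: ler_wpM2r.
have z0 : 0 < Normc.normc z by exact: lt_trans zt.
(* Above the threshold [s = a z] and [t = (1 - a) |z|], so the claim becomes [1 - a] times
   Cauchy-Schwarz for [z] and [w]. *)
pose a := 1 - t / Normc.normc z.
have sE : s = a%:C * z.
  rewrite sE0 max_l ?subr_ge0 1?ltW // /csign ifF; last first.
    by apply/negbTE; apply: contraTneq z0 => ->; rewrite Normc.normc0 ltxx.
  have -> : `|z| = (Normc.normc z)%:C by [].
  rewrite /a mulrA mulrAC -fmorphV -rmorphM /= mulrBl divff ?gt_eqF //.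
have a0 : 0 <= a.
  by rewrite /a subr_ge0 ler_pdivrMr // mul1r ltW.
have -> : Normc.normc s = a * Normc.normc z.
  by rewrite sE Normc.normcM normcR.
have tE : t = (1 - a) * Normc.normc z by rewrite /a; field; rewrite gt_eqF.
have zE := sqr_normcE z.
have a1 : 0 <= 1 - a by rewrite /a opprB addrC subrK divr_ge0 ?ltW.
have h := ler_wpM2l a1 zw.
rewrite sE {}tE; clearbody a; move: zE h.
move: (Normc.normc z) (Normc.normc w) => N W; clear -a.
case: z => x y; case: w => p q /=; rewrite !mul0r !(subr0, addr0) => zE h.
apply: le_trans (_ : (1 - a) * (x * p + y * q) - (1 - a) * a * N ^+ 2 <= _).
  by rewrite zE le_eqVlt; apply/orP; left; apply/eqP; ring.
have -> : (1 - a) * N * (W - a * N) = (1 - a) * (N * W) - (1 - a) * a * N ^+ 2.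
  by ring.
exact: lerB.
Qed.

(** Both sides are sums over the entries, so the scalar inequality adds up. This is the only
    property of the shrinkage that the convergence proof uses. *)
Lemma shrink_prox {R : realType} {p : nat} (u w : 'cV[R[i]]_p) (t : R) : 0 < t ->
  dot (u - shrink u t) (w - shrink u t) <= t * (norm1 w - norm1 (shrink u t)).
Proof.
move=> t0; rewrite dotE /norm1 -sumrB mulr_sumr; apply: ler_sum => i _.
by rewrite !mxE; exact: prox_normc.
Qed.

(** * Entrywise convergence of complex vectors *)

Lemma cvg_sumr {R : realType} {I : Type} (s : seq I) (P : pred I)
    (f : nat -> I -> R) (l : I -> R) :
  (forall i, f k i @[k --> \oo] --> l i) ->
  \sum_(i <- s | P i) f k i @[k --> \oo] --> \sum_(i <- s | P i) l i.
Proof.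
move=> fl; elim: s => [|j s IH].
  by rewrite big_nil; under eq_fun do rewrite big_nil; exact: cvg_cst.
rewrite big_cons; under eq_fun do rewrite big_cons.
by case: (P j) => //; exact: cvgD.
Qed.

(** Splitting into real and imaginary parts makes limit theorems for real sequences applicable;
    [cvg_entries_mx] translates back to the matrix topology. *)
Definition cvg_entries {R : realType} {p : nat} (u : nat -> 'cV[R[i]]_p)
    (l : 'cV[R[i]]_p) : Prop :=
  forall i, (complex.Re (u k i ord0) @[k --> \oo] --> complex.Re (l i ord0)) /\
            (complex.Im (u k i ord0) @[k --> \oo] --> complex.Im (l i ord0)).

Lemma cvg_entries_cst {R : realType} {p : nat} (l : 'cV[R[i]]_p) :
  cvg_entries (fun=> l) l.
Proof. by move=> i; split; exact: cvg_cst. Qed.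

Lemma cvg_entriesD {R : realType} {p : nat} (u v : nat -> 'cV[R[i]]_p) l l' :
  cvg_entries u l -> cvg_entries v l' ->
  cvg_entries (fun k => u k + v k) (l + l').
Proof.
move=> ul vl i; have [ur ui] := ul i; have [vr vi] := vl i.
rewrite mxE !raddfD; split; under eq_fun do rewrite mxE raddfD; exact: cvgD.
Qed.

Lemma cvg_entriesN {R : realType} {p : nat} (u : nat -> 'cV[R[i]]_p) l :
  cvg_entries u l -> cvg_entries (fun k => - u k) (- l).
Proof.
move=> ul i; have [ur ui] := ul i.
rewrite mxE !raddfN; split; under eq_fun do rewrite mxE raddfN; exact: cvgN.
Qed.

Lemma cvg_entries_mulmx {R : realType} {p q : nat} (A : 'M[R[i]]_(p, q))
    (u : nat -> 'cV[R[i]]_q) l :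
  cvg_entries u l -> cvg_entries (fun k => A *m u k) (A *m l).
Proof.
move=> ul i.
have ReM (a z : R[i]) : complex.Re (a * z) =
    complex.Re a * complex.Re z - complex.Im a * complex.Im z.
  by case: a => a1 a2; case: z => z1 z2.
have ImM (a z : R[i]) : complex.Im (a * z) =
    complex.Re a * complex.Im z + complex.Im a * complex.Re z.
  by case: a => a1 a2; case: z => z1 z2.
rewrite mxE !raddf_sum; split; under eq_fun do rewrite mxE raddf_sum.
  apply: cvg_sumr => j; have [ur ui] := ul j.
  rewrite /= ReM; under eq_fun do rewrite ReM.
  by apply: cvgB; apply: cvgMl_tmp.
apply: cvg_sumr => j; have [ur ui] := ul j.
rewrite /= ImM; under eq_fun do rewrite ImM.
by apply: cvgD; apply: cvgMl_tmp.
Qed.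

Lemma cvg_entriesZ {R : realType} {p : nat} (a : R) (u : nat -> 'cV[R[i]]_p) l :
  cvg_entries u l -> cvg_entries (fun k => a%:C *: u k) (a%:C *: l).
Proof.
move=> ul; rewrite -mul_scalar_mx.
by under eq_fun do rewrite -mul_scalar_mx; exact: cvg_entries_mulmx.
Qed.

Lemma cvg_entries_dot {R : realType} {p : nat} (u v : nat -> 'cV[R[i]]_p) l l' :
  cvg_entries u l -> cvg_entries v l' ->
  dot (u k) (v k) @[k --> \oo] --> dot l l'.
Proof.
move=> ul vl; rewrite dotE; under eq_fun do rewrite dotE.
apply: cvg_sumr => j; have [ur ui] := ul j; have [vr vi] := vl j.
by apply: cvgD; exact: cvgM.
Qed.

Lemma cvg_entries_norm1 {R : realType} {p : nat} (u : nat -> 'cV[R[i]]_p) l :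
  cvg_entries u l -> norm1 (u k) @[k --> \oo] --> norm1 l.
Proof.
move=> ul; apply: cvg_sumr => j; have [ur ui] := ul j.
have normcE (z : R[i]) : Normc.normc z =
  Num.sqrt (complex.Re z * complex.Re z + complex.Im z * complex.Im z).
  by case: z => a c; rewrite /= !expr2.
rewrite normcE; under eq_fun do rewrite normcE.
apply: cvg_comp; last exact: sqrt_continuous.
by apply: cvgD; exact: cvgM.
Qed.

Lemma cvg_entries_sub {R : realType} {p : nat} (u : nat -> 'cV[R[i]]_p) l
    (f : nat -> nat) : f @ \oo --> \oo ->
  cvg_entries u l -> cvg_entries (u \o f) l.
Proof.
move=> foo ul i; have [ur ui] := ul i.
by split; [exact: (cvg_comp _ _ foo ur) | exact: (cvg_comp _ _ foo ui)].
Qed.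

Lemma sqr_Re_le_dot {R : realType} {p : nat} (u : 'cV[R[i]]_p) i :
  complex.Re (u i ord0) ^+ 2 <= dot u u.
Proof.
rewrite dot_normc (bigD1 i) //= sqr_normcE -addrA lerDl addr_ge0 ?sqr_ge0 //.
by apply: sumr_ge0 => j _; exact: sqr_ge0.
Qed.

Lemma sqr_Im_le_dot {R : realType} {p : nat} (u : 'cV[R[i]]_p) i :
  complex.Im (u i ord0) ^+ 2 <= dot u u.
Proof.
rewrite dot_normc (bigD1 i) //= sqr_normcE [X in X + _]addrC -addrA.
rewrite lerDl addr_ge0 ?sqr_ge0 //.
by apply: sumr_ge0 => j _; exact: sqr_ge0.
Qed.

Lemma cvg_sqr0 {R : realType} (a d : nat -> R) (l : R) :
  (forall k, (a k - l) ^+ 2 <= d k) -> d @ \oo --> (0 : R) -> a @ \oo --> l.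
Proof.
move=> ad d0; apply/cvgrPdist_lt => e e0.
have e20 : 0 < e ^+ 2 by exact: exprn_gt0.
move/cvgrPdist_lt/(_ _ e20): d0; apply: filterS => k.
rewrite sub0r normrN => dk.
rewrite distrC -ltr_sqr ?nnegrE ?normr_ge0 1?ltW // real_normK ?num_real //.
by apply: le_lt_trans (ad k) _; apply: le_lt_trans dk; exact: ler_norm.
Qed.

Lemma cvg_entries_of_dot {R : realType} {p : nat} (u : nat -> 'cV[R[i]]_p) l :
  dot (u k - l) (u k - l) @[k --> \oo] --> (0 : R) -> cvg_entries u l.
Proof.
move=> ul i; split; apply: cvg_sqr0 ul => k.
  by have := sqr_Re_le_dot (u k - l) i; rewrite !mxE raddfB.
by have := sqr_Im_le_dot (u k - l) i; rewrite !mxE raddfB.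
Qed.

(** * Compactness and the return to the matrix topology *)

Lemma increasing_seq_cvg (f : nat -> nat) : increasing_seq f -> f @ \oo --> \oo.
Proof.
move=> /increasing_seqP fi A [N _ NA].
have kf k : (k <= f k)%N.
  by elim: k => // k IH; apply: leq_ltn_trans IH _; exact: fi.
by exists N => // k /= Nk; apply: NA => /=; exact: leq_trans Nk (kf k).
Qed.

Lemma succ_cvg : succn @ \oo --> \oo.
Proof. by apply: increasing_seq_cvg => k k'. Qed.

(** Subsequences are extracted one index at a time along the finite list [s]; the indices already
    treated keep converging along the finer extraction [f \o g]. *)
Lemma bolzano_weierstrass_family {R : realType} {I : eqType} (u : nat -> I -> R)
    (M : R) (s : seq I) : (forall k i, `|u k i| <= M) ->
  exists f : nat -> nat, increasing_seq f /\
    forall i, i \in s -> cvgn (fun k => u (f k) i).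
Proof.
move=> uM; elim: s => [|j s [f [fi fs]]]; first by exists id; split.
have [|g gi gj] := @bolzano_weierstrass R (fun k => u (f k) j).
  exists M; split; first exact: num_real.
  by move=> x Mx k _ /=; apply: le_trans (uM _ _) (ltW Mx).
exists (f \o g); split => [k k'|i]; first by rewrite /= fi; exact: gi.
rewrite inE => /predU1P[->|/fs ci]; first exact: gj.
apply/cvg_ex; case/cvg_ex: ci => l ul; exists l.
exact: (cvg_comp _ _ (increasing_seq_cvg _ gi) ul).
Qed.

Lemma bounded_subsequence {R : realType} {p : nat} (u : nat -> 'cV[R[i]]_p)
    (M : R) : (forall k, dot (u k) (u k) <= M) ->
  exists f l, f @ \oo --> \oo /\ cvg_entries (u \o f) l.
Proof.
move=> uM.
(* The [2 p] real coordinates of a vector: [true] selects real parts, [false] imaginary parts. *)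
pose w k (c : bool * 'I_p) :=
  if c.1 then complex.Re (u k c.2 ord0) else complex.Im (u k c.2 ord0).
have M0 : 0 <= M by exact: le_trans (dot_ge0 (u 0%N)) (uM 0%N).
have wM k c : `|w k c| <= Num.sqrt M.
  rewrite -sqrtr_sqr ler_wsqrtr // (le_trans _ (uM k)) // /w.
  by case: c.1; [exact: sqr_Re_le_dot | exact: sqr_Im_le_dot].
have [f [fi fc]] :=
  bolzano_weierstrass_family w _ (enum [set: bool * 'I_p]%SET) wM.
exists f, (\col_i (limn (fun k => w (f k) (true, i)) +i*
                   limn (fun k => w (f k) (false, i)))).
split; first exact: increasing_seq_cvg.
by move=> i; rewrite !mxE /=; split; apply: (fc (_, i)); rewrite mem_enum inE.
Qed.

Lemma cvg_entries_mx {R : realType} {p : nat} (u : nat -> 'cV[R[i]]_p) l :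
  cvg_entries u l -> u k @[k --> \oo] --> l.
Proof.
move=> ul; apply/cvg_ballP => e e0.
(* The radius of a ball lies in [R[i]]; being positive, it is real. *)
have eE : e = (complex.Re e)%:C.
  by move: e0; rewrite ltcE; case: e => a c /= /andP[/eqP-> _].
have d0 : 0 < complex.Re e by move: e0; rewrite ltcE => /andP[].
(* Half the radius for each part suffices, because [2 (e / 2)^2 < e^2]. *)
have d20 : 0 < complex.Re e / 2 by rewrite divr_gt0.
suff : \forall k \near \oo, forall i : 'I_p,
    Normc.normc (l i ord0 - u k i ord0) < complex.Re e.
  apply: filterS => k uk; split => // i j; rewrite ord1.
  rewrite eE /ball /= /ball_ /=.
  by move: (uk i); rewrite -ltcR.
apply: filter_forall => i; have [/cvgrPdist_lt ur /cvgrPdist_lt ui] := ul i.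
move: (ur _ d20) (ui _ d20); apply: filterS2 => k.
rewrite -!raddfB -ltr_sqr ?nnegrE ?normr_ge0 1?ltW // => ur1.
rewrite -ltr_sqr ?nnegrE ?normr_ge0 1?ltW // => ui1.
rewrite -ltr_sqr ?nnegrE ?normc_ge0 1?ltW // sqr_normcE.
rewrite !real_normK ?num_real // in ur1 ui1.
by have := sqr_ge0 (complex.Re e); nra.
Qed.

(** * The l1 norm, optimality conditions and existence of a KKT pair *)

Lemma norm1_ge0 {R : realType} {p : nat} (u : 'cV[R[i]]_p) : 0 <= norm1 u.
Proof. by apply: sumr_ge0 => j _; exact: normc_ge0. Qed.

Lemma norm1_convex {R : realType} {p : nat} (u v : 'cV[R[i]]_p) (t : R) :
  0 <= t <= 1 ->
  norm1 (u + t%:C *: (v - u)) <= norm1 u + t * (norm1 v - norm1 u).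
Proof.
move=> /andP[t0 t1].
have -> : u + t%:C *: (v - u) = (1 - t)%:C *: u + t%:C *: v.
  by rewrite rmorphB rmorph1 scalerBr scalerBl scale1r addrA addrAC.
have -> : norm1 u + t * (norm1 v - norm1 u) = (1 - t) * norm1 u + t * norm1 v.
  by ring.
rewrite /norm1 !mulr_sumr -big_split; apply: ler_sum => j _.
rewrite !mxE; apply: le_trans (le_normcD _ _) _.
by rewrite !Normc.normcM !normcR ?subr_ge0.
Qed.

(** Each modulus is at most the whole sum. Sublevel sets of the l1 norm are thus bounded in the
    Euclidean norm, which gives the minimizing sequence its compactness. *)
Lemma dot_le_norm1 {R : realType} {p : nat} (u : 'cV[R[i]]_p) :
  dot u u <= norm1 u ^+ 2.
Proof.
rewrite dot_normc /norm1 expr2 mulr_suml; apply: ler_sum => j _.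
rewrite expr2; apply: ler_wpM2l; first exact: normc_ge0.
by rewrite (bigD1 j) //= lerDl sumr_ge0 // => k _; exact: normc_ge0.
Qed.

Lemma cvg_entries_unique {R : realType} {p : nat} (u : nat -> 'cV[R[i]]_p) l l' :
  cvg_entries u l -> cvg_entries u l' -> l = l'.
Proof.
move=> ul ul'; apply/colP => j; have [ur ui] := ul j; have [ur' ui'] := ul' j.
have := cvg_lim (@Rhausdorff R) ur; have := cvg_lim (@Rhausdorff R) ui.
rewrite (cvg_lim (@Rhausdorff R) ur') (cvg_lim (@Rhausdorff R) ui').
by case: (l j ord0) => a c; case: (l' j ord0) => d e /= -> ->.
Qed.

(* The variational form of [A^t* *m ys \in \partial norm1 xs]; [mu *: ys] is the
   residual, so [ys] is the multiplier of the constraint. *)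
Definition kkt {R : realType} {m n : nat} (A : 'M[R[i]]_(m, n))
    (b : 'cV[R[i]]_m) (mu : R) (xs : 'cV[R[i]]_n) (ys : 'cV[R[i]]_m) : Prop :=
  A *m xs + mu%:C *: ys = b /\
  forall z, dot ys (A *m (z - xs)) <= norm1 z - norm1 xs.

(** For a feasible competitor, [A (z - xs) = mu ys - r']. The objective gap is then the slack of the
    subgradient inequality plus [|r' - mu ys|^2 / (2 mu)]. *)
Lemma kkt_solution {R : realType} {m n : nat} (A : 'M[R[i]]_(m, n)) b mu xs ys :
  0 < mu -> kkt A b mu xs ys -> is_solution A b mu (mu%:C *: ys) xs.
Proof.
move=> mu0 [feas VI]; split => // r' z feas'.
rewrite /objective !sqr_norm2; have := VI z.
have Ez : A *m (z - xs) = mu%:C *: ys - r'.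
  by rewrite mulmxBr; apply/eqP; rewrite subr_eq addrAC eq_sym subr_eq
    [mu%:C *: ys + _]addrC feas -feas'.
rewrite Ez dotDr dotNr dotZr; have := dot_ge0 (r' - mu%:C *: ys).
rewrite !(dotDl, dotDr, dotNl, dotNr, dotZl, dotZr) (dotC r' ys).
move: (dot ys ys) (dot ys r') (dot r' r') (norm1 z) (norm1 xs) => P S Q N M h1 h2.
rewrite -subr_ge0;
have -> : N + (2 * mu)^-1 * Q - (M + (2 * mu)^-1 * (mu * (mu * P))) =
   (N - M - (mu * P - S)) + (2 * mu)^-1 * (Q - mu * S - (mu * S - mu * (mu * P))).
  by field; rewrite gt_eqF.
apply: addr_ge0; first by rewrite subr_ge0.
apply: mulr_ge0; first by rewrite invr_ge0 mulr_ge0 // ltW.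
by lra.
Qed.

(** Letting [t] tend to 0 yields first-order optimality conditions without derivatives. *)
Lemma affine_ge0 {R : realType} (a c : R) : 0 <= c ->
  (forall t, 0 < t -> t <= 1 -> 0 <= a + t * c) -> 0 <= a.
Proof.
move=> c0 h; rewrite leNgt; apply/negP => a0.
have ca : 0 < 2 * (c - a) by lra.
(* For [a < 0] this point lies in [(0, 1]] and gives the negative value [a (c - 2 a) / (2 (c - a))];
   its denominator is nonzero even when [c = 0]. *)
have := h (- a / (2 * (c - a))).
rewrite divr_gt0 ?oppr_gt0 // ler_pdivrMr // => /(_ isT).
have -> : - a <= 1 * (2 * (c - a)) by lra.
move=> /(_ isT); have -> : a + - a / (2 * (c - a)) * c =
  a * (c - 2 * a) / (2 * (c - a)).
  by field; lra.
rewrite leNgt => /negP; apply; rewrite pmulr_llt0 ?invr_gt0 // nmulr_rlt0 //; lra.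
Qed.

(** Direct method: [F] dominates the l1 norm, so a minimizing sequence is bounded, and by continuity
    of [F] a cluster point attains the infimum. *)
Lemma penalized_argmin {R : realType} {m n : nat} (A : 'M[R[i]]_(m, n)) b (mu : R) :
  0 < mu -> exists xs, forall z,
    norm1 xs + (2 * mu)^-1 * dot (b - A *m xs) (b - A *m xs) <=
    norm1 z + (2 * mu)^-1 * dot (b - A *m z) (b - A *m z).
Proof.
move=> mu0.
pose F z := norm1 z + (2 * mu)^-1 * dot (b - A *m z) (b - A *m z).
have F1 z : norm1 z <= F z.
  by rewrite lerDl mulr_ge0 ?dot_ge0 // invr_ge0 mulr_ge0 // ltW.
have Finf : has_inf (range F).
  split; first by exists (F 0), 0.
  by exists 0 => _ [z _ <-]; exact: le_trans (norm1_ge0 z) (F1 z).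
(* The gap [harmonic k = 1 / (k + 1)] tends to 0 and is at most 1, hence the bound with [inf + 1]
   below. *)
have /choice[u uP] : forall k, exists z, F z < inf (range F) + harmonic k.
  move=> k; have [|_ [z _ <-] Fz] := @inf_adherent _ _ (harmonic k : R) _ Finf.
    by rewrite /= invr_gt0 ltr0n.
  by exists z.
have uM k : dot (u k) (u k) <= (inf (range F) + 1) ^+ 2.
  have u1 : norm1 (u k) <= inf (range F) + 1.
    apply: le_trans (F1 _) _; apply: le_trans (ltW (uP k)) _.
    by rewrite lerD2l invf_le1 ?ler1n ?ltr0n.
  apply: le_trans (dot_le_norm1 _) _.
  by rewrite ler_sqr ?nnegrE ?norm1_ge0 // (le_trans (norm1_ge0 _) u1).
have [f [l [foo fl]]] := bounded_subsequence u _ uM.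
exists l => z; apply: (@le_trans _ _ (inf (range F))); last first.
  by apply: ge_inf; [case: Finf | exists z].
have Fl : F (u (f k)) @[k --> \oo] --> F l.
  have bA : cvg_entries (fun k => b - A *m u (f k)) (b - A *m l).
    apply: cvg_entriesD; first exact: cvg_entries_cst.
    by apply: cvg_entriesN; exact: cvg_entries_mulmx fl.
  apply: cvgD; first exact: cvg_entries_norm1 fl.
  by apply: cvgMl_tmp; exact: cvg_entries_dot.
have hl : inf (range F) + harmonic (f k) @[k --> \oo] --> inf (range F).
  rewrite -[X in _ --> X]addr0; apply: cvgD; first exact: cvg_cst.
  exact: (cvg_comp _ _ foo (@cvg_harmonic R)).
apply: (ler_cvg_to Fl hl); apply: nearW => k; exact: ltW.
Qed.

(** The multiplier is the residual of a minimizer divided by [mu]. Its variational inequality is the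
    first-order condition along the segment from [xs] to [z]. *)
Lemma kkt_exists {R : realType} {m n : nat} (A : 'M[R[i]]_(m, n)) b (mu : R) :
  0 < mu -> exists xs ys, kkt A b mu xs ys.
Proof.
move=> mu0; have [xs xsP] := penalized_argmin A b mu mu0.
exists xs, (mu^-1%:C *: (b - A *m xs)); split => [|z].
  by rewrite scalerA -rmorphM /= divff ?gt_eqF // scale1r addrC subrK.
rewrite -subr_ge0; set a := (X in 0 <= X).
apply: (@affine_ge0 _ _ ((2 * mu)^-1 * dot (A *m (z - xs)) (A *m (z - xs)))).
  by rewrite mulr_ge0 ?dot_ge0 // invr_ge0 mulr_ge0 // ltW.
move=> t t0 t1; have := xsP (xs + t%:C *: (z - xs)).
have : 0 <= t <= 1 by rewrite t1 ltW.
move/(norm1_convex xs z t); rewrite /a dotZl.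
move: (norm1 (_ + _)) (norm1 z) (norm1 xs) => Nt N M.
rewrite mulmxDr -scalemxAr opprD addrA.
move: (b - A *m xs) (A *m (z - xs)) => v w.
rewrite !(dotDl, dotDr, dotNl, dotNr, dotZl, dotZr) (dotC w v).
move: (dot v v) (dot v w) (dot w w) => P S Q h1 h2.
(* After multiplication by [t], the quantity is the convexity slack of the l1 norm plus the growth
   of the objective away from its minimizer. *)
rewrite -(pmulr_rge0 _ t0).
have -> : t * (N - M - mu^-1 * S + t * ((2 * mu)^-1 * Q)) =
  (M + t * (N - M) - Nt) + (Nt + (2 * mu)^-1 *
     (P - t * S + (- (t * S) + t * (t * Q))) - (M + (2 * mu)^-1 * P)).
  by field; rewrite gt_eqF.
by apply: addr_ge0; rewrite subr_ge0 //; move: h2; rewrite ?opprK ?opprD ?opprK.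
Qed.

(** * One iteration and the decrease of the Lyapunov function *)

Definition adm_step {R : realType} {m n : nat} (A : 'M[R[i]]_(m, n))
    (b : 'cV[R[i]]_m) (mu beta tau gamma : R) (x : 'cV[R[i]]_n)
    (y r1 : 'cV[R[i]]_m) (x1 : 'cV[R[i]]_n) (y1 : 'cV[R[i]]_m) : Prop :=
  [/\ r1 = (mu * beta / (1 + mu * beta))%:C *: (beta^-1%:C *: y - (A *m x - b)),
      x1 = shrink (x - tau%:C *: (A^t* *m (A *m x + r1 - b - beta^-1%:C *: y)))
             (tau / beta) &
      y1 = y - (gamma * beta)%:C *: (A *m x1 + r1 - b)].

(** Clearing the denominator [1 + mu beta] recovers the stationarity condition of the residual step:
    [r / mu] equals the predicted multiplier [y - beta (v + r)]. *)
Lemma scale_residual {R : realType} {p : nat} (mu beta : R) (r y v : 'cV[R[i]]_p) :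
  0 < mu -> 0 < beta ->
  r = (mu * beta / (1 + mu * beta))%:C *: (beta^-1%:C *: y - v) ->
  r = mu%:C *: (y - beta%:C *: (v + r)).
Proof.
move=> mu0 beta0 rE.
have mb0 : 1 + mu * beta != 0 by rewrite gt_eqF // ltr_pwDl // mulr_ge0 // ltW.
have {}rE : (1 + mu * beta)%:C *: r = mu%:C *: y - (mu * beta)%:C *: v.
  rewrite rE scalerA -rmorphM /= mulrC divfK // scalerBr scalerA -rmorphM /=.
  by rewrite mulfK ?gt_eqF.
rewrite scalerBr scalerA -rmorphM /= scalerDr opprD addrA -rE rmorphD rmorph1.
by rewrite scalerDl scale1r addrK.
Qed.

(** The gradient is [- A^t* v / beta] with [v] the predicted multiplier. Scaled by [beta / tau], the
    proximal inequality says that [A^t* v + (beta / tau) (x - x1)] is a subgradient of the l1 norm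
    at [x1]. *)
Lemma step_prox {R : realType} {m n : nat} (A : 'M[R[i]]_(m, n)) b
    (beta tau : R) x y r1 x1 : 0 < beta -> 0 < tau ->
  x1 = shrink (x - tau%:C *: (A^t* *m (A *m x + r1 - b - beta^-1%:C *: y)))
         (tau / beta) ->
  forall z, beta / tau * dot (x - x1) (z - x1) +
    dot (y - beta%:C *: (A *m x - b + r1)) (A *m (z - x1)) <= norm1 z - norm1 x1.
Proof.
move=> beta0 tau0 x1E z.
set v := y - _.
have vE : A *m x + r1 - b - beta^-1%:C *: y = (- beta^-1)%:C *: v.
  rewrite rmorphN scaleNr /v scalerBr scalerA -rmorphM /= mulVf ?gt_eqF //.
  by rewrite rmorph1 scale1r opprB [A *m x + r1 - b]addrAC.
have tb0 : 0 < tau / beta by exact: divr_gt0.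
have := shrink_prox (x - tau%:C *: (A^t* *m (A *m x + r1 - b - beta^-1%:C *: y)))
  z _ tb0.
rewrite -x1E vE -scalemxAr addrAC dotDl dotNl !dotZl.
rewrite [dot (A^t* *m v) _]dotC -dot_adjoint (dotC (A *m _)).
move: (dot v _) (dot _ _) (norm1 z - norm1 x1) => P Q N h.
rewrite -(ler_pM2l tb0); apply: le_trans h; rewrite le_eqVlt; apply/orP; left.
by apply/eqP; field; rewrite !gt_eqF.
Qed.

Definition lyapunov {R : realType} {m n : nat} (beta tau gamma : R)
    (xs x : 'cV[R[i]]_n) (ys y : 'cV[R[i]]_m) : R :=
  beta / tau * dot (x - xs) (x - xs) + (gamma * beta)^-1 * dot (y - ys) (y - ys).

(* [s] splits the gap between [tau * l] and [2 - gamma]; the cross term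
   <A dx, dy> is absorbed by Young's inequality with weight gamma * beta / s. *)
Lemma lyapunov_decrease {R : realType} {m n : nat} (A : 'M[R[i]]_(m, n)) b
    (mu beta tau gamma l s : R) x y r1 x1 y1 xs ys :
  0 < mu -> 0 < beta -> 0 < tau -> 0 < gamma -> 0 < s ->
  (forall u, dot (A *m u) (A *m u) <= l * dot u u) ->
  adm_step A b mu beta tau gamma x y r1 x1 y1 -> kkt A b mu xs ys ->
  beta * (s - tau * l) / (tau * s) * dot (x - x1) (x - x1) +
    (2 - gamma - s) / (gamma ^+ 2 * beta) * dot (y - y1) (y - y1)
  <= lyapunov beta tau gamma xs x ys y - lyapunov beta tau gamma xs x1 ys y1.
Proof.
move=> mu0 beta0 tau0 gamma0 s0 Al [r1E x1E y1E] [feas VIs].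
have := step_prox A b beta tau x y r1 x1 beta0 tau0 x1E xs.
have := scale_residual mu beta r1 y (A *m x - b) mu0 beta0 r1E.
set v := y - beta%:C *: _ => r1v VI.
(* [e] is the error of the predicted multiplier, [ex] and [ey] are the errors after the step, [dx]
   and [dy] the decrements. *)
pose e := v - ys; pose ex := x1 - xs; pose dx := x - x1.
pose ey := y1 - ys; pose dy := y - y1.
have gb0 : gamma * beta != 0 by rewrite mulf_neq0 ?gt_eqF.
(* As [mu e = r1 - mu ys], feasibility of the KKT pair turns the left side into the new constraint
   residual [A x1 + r1 - b]. *)
have AexE : A *m ex + mu%:C *: e = (gamma * beta)^-1%:C *: dy.
  rewrite /dy y1E opprD opprK addrA subrr add0r scalerA -rmorphM /= mulVf //.
  rewrite rmorph1 scale1r /e scalerBr -r1v /ex mulmxBr -feas opprD.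
  by rewrite addrACA addrA.
(* The residual [A x - b + r1] is [A dx] plus the residual at [x1], and the latter is
   [dy / (gamma beta)]. *)
have eE : e = ey + dy - beta%:C *: (A *m dx) - gamma^-1%:C *: dy.
  have -> : ey + dy = y - ys by rewrite /ey /dy addrC addrA subrK.
  have -> : gamma^-1%:C *: dy = beta%:C *: ((gamma * beta)^-1%:C *: dy).
    by rewrite scalerA -rmorphM /= invfM mulrCA divff ?gt_eqF // mulr1.
  rewrite -addrA -opprD -scalerDr -AexE addrA -mulmxDr.
  have -> : dx + ex = x - xs by rewrite /dx /ex addrA subrK.
  have -> : A *m (x - xs) + mu%:C *: e = A *m x - b + r1.
    rewrite /e scalerBr -r1v mulmxBr -feas opprD !addrA.
    by rewrite [RHS]addrAC.
  by rewrite /e /v addrAC.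
(* Monotonicity of the subdifferential: the inequalities at [x1] and at [xs] are added, and the l1
   norms cancel. *)
have h1 : 0 <= beta / tau * dot dx ex + dot e (A *m ex).
  have := VIs x1; move: VI; rewrite -/ex -/dx -[xs - x1]opprB -/ex mulmxN !dotNr.
  rewrite /e dotDl dotNl.
  move: (dot dx ex) (dot v _) (dot ys _) (norm1 x1) (norm1 xs) => *; lra.
have AexE' : A *m ex = (gamma * beta)^-1%:C *: dy - mu%:C *: e.
  by rewrite -AexE addrK.
have ge0 : 0 < gamma * beta / s by rewrite divr_gt0 ?mulr_gt0.
have xE : x - xs = dx + ex by rewrite /dx /ex addrA subrK.
have yE : y - ys = ey + dy by rewrite /ey /dy [RHS]addrC addrA subrK.
rewrite /lyapunov xE yE -/dx -/ex -/dy -/ey.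
clearbody e ex dx ey dy.
have := dot_young _ (- (A *m dx)) dy ge0.
rewrite !(dotNl, dotNr) opprK.
have h3 := Al dx; have h4 := dot_ge0 e.
(* Only the [e] paired with [dy] is expanded; [dot e e] stays, since its sign is known. *)
rewrite AexE' dotDr dotNr !dotZr {1}eE in h1; move: h1.
rewrite !(dotDl, dotDr, dotNl, dotZl) (dotC ex dx) (dotC dy ey).
move: h3 h4; move: (dot (A *m dx) (A *m dx)) (dot (A *m dx) dy) => PA S.
move: (dot dx dx) (dot dx ex) (dot ex ex) (dot dy dy) (dot ey dy) (dot ey ey).
move: (dot e e) => E P T X Q U Y h3 h4 h1 h2.
have hP : gamma * beta / s * PA <= gamma * beta / s * (l * P).
  by rewrite ler_pM2l.
rewrite -subr_ge0; set D := (X in 0 <= X).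
(* The slack is twice [h1], plus [2 mu E], plus the Young bound over [gamma], whose [2 S] cancels
   the cross term. *)
have -> : D = 2 * (beta / tau * T + ((gamma * beta)^-1 *
     (U + Q - beta * S - gamma^-1 * Q) - mu * E)) + 2 * (mu * E) +
   gamma^-1 * (gamma * beta / s * (l * P) + (gamma * beta / s)^-1 * Q + 2 * S).
  by rewrite /D; field; rewrite !gt_eqF.
apply: addr_ge0; first apply: addr_ge0.
- by rewrite mulr_ge0.
- by rewrite !mulr_ge0 // ltW.
- by apply: mulr_ge0; [rewrite invr_ge0 ltW | lra].
Qed.

(** * Cluster points of the iteration *)

(** Vanishing increments give old and new iterates the same limits along [f], so the update formulas
    and the proximal inequality pass to the limit. *)
Lemma kkt_limit {R : realType} {m n : nat} (A : 'M[R[i]]_(m, n)) b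
    (mu beta tau gamma : R) (r : nat -> 'cV[R[i]]_m) (x : nat -> 'cV[R[i]]_n)
    (y : nat -> 'cV[R[i]]_m) (f : nat -> nat) xt yt :
  0 < mu -> 0 < beta -> 0 < tau -> 0 < gamma ->
  (forall k,
     adm_step A b mu beta tau gamma (x k) (y k) (r k.+1) (x k.+1) (y k.+1)) ->
  f @ \oo --> \oo -> cvg_entries (x \o f) xt -> cvg_entries (y \o f) yt ->
  cvg_entries (fun k => x k - x k.+1) 0 -> cvg_entries (fun k => y k - y k.+1) 0 ->
  kkt A b mu xt yt.
Proof.
move=> mu0 beta0 tau0 gamma0 step foo xf yf dx0 dy0.
have dxf := cvg_entries_sub _ _ _ foo dx0.
have dyf := cvg_entries_sub _ _ _ foo dy0.
have x1f : cvg_entries (fun k => x (f k).+1) xt.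
  rewrite -[xt]subr0.
  have -> : (fun k => x (f k).+1) = fun k => x (f k) - (x (f k) - x (f k).+1).
    by apply/funext => k; rewrite subKr.
  by apply: cvg_entriesD => //; exact: cvg_entriesN.
pose rt := (mu * beta / (1 + mu * beta))%:C *: (beta^-1%:C *: yt - (A *m xt - b)).
have rf : cvg_entries (fun k => r (f k).+1) rt.
  have -> : (fun k => r (f k).+1) = fun k => (mu * beta / (1 + mu * beta))%:C *:
      (beta^-1%:C *: y (f k) - (A *m x (f k) - b)).
    by apply/funext => k; case: (step (f k)).
  apply: cvg_entriesZ; apply: cvg_entriesD; first exact: cvg_entriesZ.
  apply: cvg_entriesN; apply: cvg_entriesD; first exact: cvg_entries_mulmx.
  exact: cvg_entries_cst.
have res0 : A *m xt - b + rt = 0.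
  (* The dual increment is [gamma beta] times the constraint residual, so the limit residual is
     zero. *)
  have : (gamma * beta)%:C *: (A *m xt + rt - b) = 0.
    apply: cvg_entries_unique dyf.
    have -> : (fun k => y k - y k.+1) \o f =
        fun k => (gamma * beta)%:C *: (A *m x (f k).+1 + r (f k).+1 - b).
      by apply/funext => k /=; case: (step (f k)) => _ _ {1}->; rewrite subKr.
    apply: cvg_entriesZ; apply: cvg_entriesD; last exact: cvg_entries_cst.
    by apply: cvg_entriesD => //; exact: cvg_entries_mulmx.
  rewrite [A *m xt + rt - b]addrAC => /eqP; rewrite scaler_eq0 => /orP[|/eqP//].
  by rewrite fmorph_eq0 mulf_eq0 !gt_eqF.
have rtE : rt = mu%:C *: yt.
  by rewrite (scale_residual mu beta rt yt (A *m xt - b)) // res0 scaler0 subr0.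
split; first by rewrite -rtE; apply/eqP; rewrite -subr_eq0 addrAC res0.
move=> z.
have zx1 : cvg_entries (fun k => z - x (f k).+1) (z - xt).
  by apply: cvg_entriesD; [exact: cvg_entries_cst | exact: cvg_entriesN].
have vf : cvg_entries
    (fun k => y (f k) - beta%:C *: (A *m x (f k) - b + r (f k).+1)) yt.
  have E : yt = yt - beta%:C *: (A *m xt - b + rt) by rewrite res0 scaler0 subr0.
  rewrite E; apply: cvg_entriesD => //; apply: cvg_entriesN; apply: cvg_entriesZ.
  apply: cvg_entriesD => //; apply: cvg_entriesD; first exact: cvg_entries_mulmx.
  exact: cvg_entries_cst.
have L : beta / tau * dot (x (f k) - x (f k).+1) (z - x (f k).+1) +
    dot (y (f k) - beta%:C *: (A *m x (f k) - b + r (f k).+1))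
        (A *m (z - x (f k).+1)) @[k --> \oo] --> dot yt (A *m (z - xt)).
  have -> : dot yt (A *m (z - xt)) =
      beta / tau * dot 0 (z - xt) + dot yt (A *m (z - xt)).
    by rewrite dot0l mulr0 add0r.
  apply: cvgD; first by apply: cvgMl_tmp; exact: cvg_entries_dot.
  by apply: cvg_entries_dot => //; exact: cvg_entries_mulmx.
have N : norm1 z - norm1 (x (f k).+1) @[k --> \oo] --> norm1 z - norm1 xt.
  by apply: cvgB; [exact: cvg_cst | exact: cvg_entries_norm1].
apply: (ler_cvg_to L N); apply: nearW => k; have [_ xE _] := step (f k).
exact: (step_prox A b beta tau _ _ _ _ beta0 tau0 xE z).
Qed.

(** * Convergence of the whole sequence *)

Lemma nonincreasing_diff_cvg0 {R : realType} (V : nat -> R) :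
  (forall k, 0 <= V k) -> (forall k, V k.+1 <= V k) ->
  cvgn V /\ V k - V k.+1 @[k --> \oo] --> (0 : R).
Proof.
move=> V0 VS.
have Vc : cvgn V.
  apply: nonincreasing_is_cvgn; first exact/nonincreasing_seqP.
  by exists 0 => _ [k _ <-].
split => //; rewrite -(subrr (limn V)); apply: cvgB => //.
exact: (cvg_comp _ _ succ_cvg Vc).
Qed.

(** The Gram bound is tested on the all-ones vector, whose squared norm [n] is positive. *)
Lemma is_max_eigenvalue_ge0 {R : realType} {m n : nat} (A : 'M[R[i]]_(m, n)) (l : R) :
  (0 < n)%N -> is_max_eigenvalue (A^t* *m A) l -> 0 <= l.
Proof.
move=> n0 lP; have := dot_Gram_le A l lP (const_mx 1).
move/(le_trans (dot_ge0 _)); rewrite pmulr_lge0 //.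
rewrite dot_normc; under eq_bigr do rewrite mxE Normc.normc1 expr1n.
by rewrite sumr_const card_ord ltr0n.
Qed.

Lemma lyapunov_ge0 {R : realType} {m n : nat} (beta tau gamma : R)
    (xs x : 'cV[R[i]]_n) (ys y : 'cV[R[i]]_m) :
  0 < beta -> 0 < tau -> 0 < gamma -> 0 <= lyapunov beta tau gamma xs x ys y.
Proof.
move=> b0 t0 g0; rewrite /lyapunov addr_ge0 // mulr_ge0 ?dot_ge0 //.
  by rewrite divr_ge0 // ltW.
by rewrite invr_ge0 mulr_ge0 // ltW.
Qed.

Lemma dot_le_lyapunov {R : realType} {m n : nat} (beta tau gamma : R)
    (xs x : 'cV[R[i]]_n) (ys y : 'cV[R[i]]_m) :
  0 < beta -> 0 < tau -> 0 < gamma ->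
  dot (x - xs) (x - xs) <= tau / beta * lyapunov beta tau gamma xs x ys y /\
  dot (y - ys) (y - ys) <= gamma * beta * lyapunov beta tau gamma xs x ys y.
Proof.
move=> b0 t0 g0; rewrite /lyapunov.
have := dot_ge0 (x - xs); have := dot_ge0 (y - ys).
move: (dot (x - xs) _) (dot (y - ys) _) => P Q Q0 P0; split; rewrite -subr_ge0.
  have -> : tau / beta * (beta / tau * P + (gamma * beta)^-1 * Q) - P =
    tau / beta * ((gamma * beta)^-1 * Q) by field; rewrite !gt_eqF.
  by rewrite !mulr_ge0 ?invr_ge0 ?mulr_ge0 // ltW.
have -> : gamma * beta * (beta / tau * P + (gamma * beta)^-1 * Q) - Q =
  gamma * beta * (beta / tau * P) by field; rewrite !gt_eqF.
by rewrite !mulr_ge0 ?invr_ge0 ?mulr_ge0 // ltW.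
Qed.

Lemma cvg0_of_scaled_le {R : realType} (d e : nat -> R) (c : R) : 0 < c ->
  (forall k, 0 <= d k) -> (forall k, d k <= c * e k) ->
  e @ \oo --> (0 : R) -> d @ \oo --> (0 : R).
Proof.
move=> c0 d0 de e0.
apply: (@squeeze_cvgr _ _ _ _ (fun=> 0) (fun k => c * e k)).
- by apply: nearW => k; rewrite d0 de.
- exact: cvg_cst.
- by rewrite -(mulr0 c); exact: cvgMl_tmp.
Qed.

Lemma adm_cvg {R : realType} {m n : nat} (A : 'M[R[i]]_(m, n)) b
    (mu beta tau gamma l : R) (r : nat -> 'cV[R[i]]_m) (x : nat -> 'cV[R[i]]_n)
    (y : nat -> 'cV[R[i]]_m) :
  (0 < n)%N -> 0 < mu -> 0 < beta -> 0 < tau -> 0 < gamma ->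
  is_max_eigenvalue (A^t* *m A) l -> tau * l + gamma < 2 ->
  (forall k,
     adm_step A b mu beta tau gamma (x k) (y k) (r k.+1) (x k.+1) (y k.+1)) ->
  exists xt yt, [/\ kkt A b mu xt yt, cvg_entries x xt & cvg_entries y yt].
Proof.
move=> n0 mu0 beta0 tau0 gamma0 lP small step.
have tl0 : 0 <= tau * l.
  by apply: mulr_ge0; [exact: ltW | exact: is_max_eigenvalue_ge0 lP].
(* The midpoint of [tau l] and [2 - gamma] makes both coefficients of the decrease positive. *)
pose s := (tau * l + (2 - gamma)) / 2.
have s0 : 0 < s by rewrite /s; lra.
have c1 : 0 < beta * (s - tau * l) / (tau * s).
  by rewrite divr_gt0 ?mulr_gt0 //; rewrite /s; lra.
have c2 : 0 < (2 - gamma - s) / (gamma ^+ 2 * beta).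
  by rewrite divr_gt0 ?mulr_gt0 ?exprn_gt0 //; rewrite /s; lra.
pose V xs ys k := lyapunov beta tau gamma xs (x k) ys (y k).
have V0 xs ys k : 0 <= V xs ys k by exact: lyapunov_ge0.
have dec xs ys k (K : kkt A b mu xs ys) := lyapunov_decrease A b mu beta tau
  gamma l s _ _ _ _ _ xs ys mu0 beta0 tau0 gamma0 s0 (dot_Gram_le A l lP) (step k) K.
have VS xs ys : kkt A b mu xs ys -> forall k, V xs ys k.+1 <= V xs ys k.
  move=> K k; rewrite -subr_ge0; apply: le_trans (dec _ _ k K).
  by apply: addr_ge0; apply: mulr_ge0; rewrite ?dot_ge0 //; exact: ltW.
have [xs [ys K]] := kkt_exists A b mu mu0.
have [_ dV] := nonincreasing_diff_cvg0 _ (V0 xs ys) (VS _ _ K).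
have dx0 : cvg_entries (fun k => x k - x k.+1) 0.
  apply: cvg_entries_of_dot.
  apply: (@cvg0_of_scaled_le _ _ _ (beta * (s - tau * l) / (tau * s))^-1
    _ _ _ dV).
  - by rewrite invr_gt0; exact: c1.
  - by move=> k; exact: dot_ge0.
  move=> k; rewrite subr0 -ler_pdivrMl ?invr_gt0 // invrK.
  apply: le_trans (dec _ _ k K); rewrite lerDl mulr_ge0 ?dot_ge0 //; exact: ltW.
have dy0 : cvg_entries (fun k => y k - y k.+1) 0.
  apply: cvg_entries_of_dot.
  apply: (@cvg0_of_scaled_le _ _ _ ((2 - gamma - s) / (gamma ^+ 2 * beta))^-1
    _ _ _ dV).
  - by rewrite invr_gt0; exact: c2.
  - by move=> k; exact: dot_ge0.
  move=> k; rewrite subr0 -ler_pdivrMl ?invr_gt0 // invrK.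
  apply: le_trans (dec _ _ k K); rewrite lerDr mulr_ge0 ?dot_ge0 //; exact: ltW.
have VM k : V xs ys k <= V xs ys 0%N.
  by elim: k => // k; apply: le_trans; exact: VS.
(* Stacking the two errors into one vector yields a common subsequence for [x] and [y]. *)
have bnd k : dot (col_mx (x k - xs) (y k - ys)) (col_mx (x k - xs) (y k - ys)) <=
    tau / beta * V xs ys 0%N + gamma * beta * V xs ys 0%N.
  have [hx hy] := dot_le_lyapunov beta tau gamma xs (x k) ys (y k) beta0 tau0 gamma0.
  rewrite dot_col_mx; apply: lerD.
    by apply: le_trans hx _; apply: ler_wpM2l; [rewrite divr_ge0 // ltW | exact: VM].
  by apply: le_trans hy _; apply: ler_wpM2l; [rewrite mulr_ge0 // ltW | exact: VM].
have [f [u [foo fu]]] := bounded_subsequence _ _ bnd.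
pose xt := usubmx u + xs; pose yt := dsubmx u + ys.
have xf : cvg_entries (x \o f) xt.
  have -> : x \o f = fun k => (x (f k) - xs) + xs.
    by apply/funext => k; rewrite subrK.
  apply: cvg_entriesD; last exact: cvg_entries_cst.
  move=> j; have := fu (lshift m j); rewrite mxE.
  by under eq_fun do rewrite /= col_mxEu;
    under [in X in _ /\ X]eq_fun do rewrite /= col_mxEu.
have yf : cvg_entries (y \o f) yt.
  have -> : y \o f = fun k => (y (f k) - ys) + ys.
    by apply/funext => k; rewrite subrK.
  apply: cvg_entriesD; last exact: cvg_entries_cst.
  move=> j; have := fu (rshift n j); rewrite mxE.
  by under eq_fun do rewrite /= col_mxEd;
    under [in X in _ /\ X]eq_fun do rewrite /= col_mxEd.
have Kt := kkt_limit A b mu beta tau gamma r x y f xt yt mu0 beta0 tau0 gamma0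
  step foo xf yf dx0 dy0.
have [Vc _] := nonincreasing_diff_cvg0 _ (V0 xt yt) (VS _ _ Kt).
have Vf0 : V xt yt (f k) @[k --> \oo] --> (0 : R).
  have d0 p (v : nat -> 'cV[R[i]]_p) vt : cvg_entries v vt ->
      dot (v k - vt) (v k - vt) @[k --> \oo] --> (0 : R).
    move=> vc; have -> : (0 : R) = dot (vt - vt) (vt - vt).
      by rewrite subrr dot0l.
    have := cvg_entriesD _ _ _ _ vc (cvg_entriesN _ _ (cvg_entries_cst vt)).
    by move=> h; exact: cvg_entries_dot.
  have -> : (0 : R) = beta / tau * 0 + (gamma * beta)^-1 * 0 by ring.
  by apply: cvgD; apply: cvgMl_tmp; [exact: d0 xf | exact: d0 yf].
(* Monotonicity gives the full sequence [V xt yt] a limit, which its subsequence along [f]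
   identifies as 0. *)
have Vl : V xt yt @ \oo --> (0 : R).
  rewrite -(cvg_lim (@Rhausdorff R) Vf0).
  by rewrite (cvg_lim (@Rhausdorff R) (cvg_comp _ _ foo Vc)).
exists xt, yt; split => //; apply: cvg_entries_of_dot.
  apply: (@cvg0_of_scaled_le _ _ _ (tau / beta) _ _ _ Vl).
  - exact: divr_gt0.
  - by move=> k; exact: dot_ge0.
  - by move=> k; case: (dot_le_lyapunov beta tau gamma xt (x k) yt (y k)).
apply: (@cvg0_of_scaled_le _ _ _ (gamma * beta) _ _ _ Vl).
- exact: mulr_gt0.
- by move=> k; exact: dot_ge0.
- by move=> k; case: (dot_le_lyapunov beta tau gamma xt (x k) yt (y k)).
Qed.

Theorem theorem2p1 (R : realType) (m n : nat) (hm : (0 < m)%N) (hmn : (m < n)%N)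
  (A : 'M[R[i]]_(m, n)) (b : 'cV[R[i]]_m) (mu : R) (hmu : 0 < mu)
  (tau gamma : R) (htau : 0 < tau) (hgamma : 0 < gamma)
  (lmax : R) (hlmax : is_max_eigenvalue (A^t* *m A) lmax)
  (hstep : tau * lmax + gamma < 2)
  (beta : R) (hbeta : 0 < beta)
  (r : nat -> 'cV[R[i]]_m) (x : nat -> 'cV[R[i]]_n) (y : nat -> 'cV[R[i]]_m)
  (hr : forall k : nat,
     r k.+1 = (mu * beta / (1 + mu * beta))%:C
                *: (beta^-1%:C *: y k - (A *m x k - b)))
  (hx : forall k : nat,
     let g := A^t* *m (A *m x k + r k.+1 - b - beta^-1%:C *: y k) in
     x k.+1 = shrink (x k - tau%:C *: g) (tau / beta))
  (hy : forall k : nat,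
     y k.+1 = y k - (gamma * beta)%:C *: (A *m x k.+1 + r k.+1 - b)) :
  exists (rt : 'cV[R[i]]_m) (xt : 'cV[R[i]]_n) (yt : 'cV[R[i]]_m),
    (r k.+1, x k.+1, y k.+1) @[k --> \oo] --> (rt, xt, yt) /\
    is_solution A b mu rt xt.
Proof.
have n0 : (0 < n)%N by exact: leq_ltn_trans hmn.
have step k : adm_step A b mu beta tau gamma (x k) (y k) (r k.+1) (x k.+1) (y k.+1).
  by split; [exact: hr | exact: hx | exact: hy].
have [xt [yt [K xc yc]]] := adm_cvg A b mu beta tau gamma lmax r x y n0 hmu hbeta
  htau hgamma hlmax hstep step.
(* The limit of the residuals by continuity of their formula; feasibility of the KKT pair reduces it
   to [mu yt]. *)
pose rt := (mu * beta / (1 + mu * beta))%:C *: (beta^-1%:C *: yt - (A *m xt - b)).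
have rtE : rt = mu%:C *: yt.
  have [feas _] := K; rewrite /rt -feas opprB addrAC subrr add0r.
  rewrite -scalerDl -rmorphD scalerA -rmorphM /=; congr (_%:C *: _).
  by field; rewrite gt_eqF //= gt_eqF // ltr_pwDl // mulr_ge0 // ltW.
have rc : cvg_entries (fun k => r k.+1) rt.
  have -> : (fun k => r k.+1) = fun k => (mu * beta / (1 + mu * beta))%:C *:
      (beta^-1%:C *: y k - (A *m x k - b)).
    by apply/funext => k; exact: hr.
  apply: cvg_entriesZ; apply: cvg_entriesD; first exact: cvg_entriesZ.
  apply: cvg_entriesN; apply: cvg_entriesD; first exact: cvg_entries_mulmx.
  exact: cvg_entries_cst.
exists rt, xt, yt; split; last by rewrite rtE; exact: kkt_solution.
(* Residuals are defined only from index 1 on, so [x] and [y] are shifted to match. *)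
have x1c := cvg_entries_mx _ _ (cvg_entries_sub _ _ _ succ_cvg xc).
have y1c := cvg_entries_mx _ _ (cvg_entries_sub _ _ _ succ_cvg yc).
exact: (cvg_pair (cvg_pair (cvg_entries_mx _ _ rc) x1c) y1c).
Qed.
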